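(* Let $M$ be the Chinese monoid of rank $n\ge1$. There exist nonnegative integers $c,d$ with $c+2d=nT_n$ and an embedding of monoids $M\hookrightarrow \mathbb{N}^c\times(B\times\mathbb{Z})^d$.
   Context: The Chinese monoid of rank $n$ is the monoid $M=\langle a_1,\dots,a_n\rangle$ defined by the relations $a_ja_ia_k=a_ja_ka_i=a_ka_ja_i$ for $i\le k\le j$. $B=\langle p,q: qp=1\rangle$ is the bicyclic monoid; $\mathbb{N}$ is the additive monoid of nonnegative integers and $\mathbb{Z}$ the additive group of integers. $(T_k)$ is the Tribonacci sequence: $T_0=T_1=T_2=1$ and $T_{k+1}=T_k+T_{k-1}+T_{k-2}$ for $k\ge2$. *)

(* Defs.v *)
From HB Require Import structures.
From mathcomp Require Import all_boot all_order all_algebra.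
From mathcomp Require Import generic_quotient boolp.

Set Implicit Arguments.
Unset Strict Implicit.
Unset Printing Implicit Defensive.

Section Presentation.
Variables (A : choiceType) (R : seq A -> seq A -> Prop).

(* The least monoid congruence on the free monoid [seq A] containing [R]. *)
Inductive word_congr : seq A -> seq A -> Prop :=
| word_congr_rel (x u v y : seq A) :
    R u v -> word_congr (x ++ u ++ y) (x ++ v ++ y)
| word_congr_refl (u : seq A) : word_congr u u
| word_congr_sym (u v : seq A) : word_congr u v -> word_congr v u
| word_congr_trans (v u w : seq A) :
    word_congr u v -> word_congr v w -> word_congr u w.

Lemma word_congr_ctx (x y u v : seq A) :
  word_congr u v -> word_congr (x ++ u ++ y) (x ++ v ++ y).
Proof.
elim=> {u v} [x' u v y' Ruv|u|u v _ IH|v u w _ IH1 _ IH2].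
- have E w : x ++ (x' ++ w ++ y') ++ y = (x ++ x') ++ w ++ (y' ++ y).
    by rewrite !catA.
  by rewrite !E; apply: word_congr_rel.
- exact: word_congr_refl.
- exact: word_congr_sym.
- exact: word_congr_trans IH1 IH2.
Qed.

Lemma word_congr_cat (u u' v v' : seq A) :
  word_congr u u' -> word_congr v v' -> word_congr (u ++ v) (u' ++ v').
Proof.
move=> /(word_congr_ctx [::] v) /= Hu /(word_congr_ctx u' [::]).
by rewrite !cats0; apply: word_congr_trans Hu.
Qed.

Definition word_congrb : rel (seq A) := fun u v => `[< word_congr u v >].

Lemma word_congrb_equiv : equiv_class_of word_congrb.
Proof.
split=> [u|u v|v u w].
- exact/asboolP/word_congr_refl.
- by apply/asboolP/asboolP; apply: word_congr_sym.
- by move=> /asboolP Huv /asboolP Hvw; apply/asboolP/(word_congr_trans Huv).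
Qed.

Canonical word_congr_equiv := EquivRelPack word_congrb_equiv.

(* The monoid presented by the generators [A] and the relations [u = v] for
   [R u v]. *)
Definition presented_monoid : Type := {eq_quot word_congrb}%qT.

HB.instance Definition _ := Choice.on presented_monoid.
HB.instance Definition _ := EqQuotient.on presented_monoid.

Definition word_class (u : seq A) : presented_monoid :=
  (\pi_presented_monoid u)%qT.

Lemma word_classP (u v : seq A) :
  word_class u = word_class v <-> word_congr u v.
Proof.
split=> [/eqquotP/asboolP //|Huv].
by apply/eqquotP/asboolP.
Qed.

Lemma word_class_repr (x : presented_monoid) : word_class (repr x) = x.
Proof. exact: reprK. Qed.

Definition presented_one : presented_monoid := word_class [::].

Definition presented_mul (x y : presented_monoid) : presented_monoid :=
  word_class (repr x ++ repr y).

Lemma presented_mulE (u v : seq A) :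
  presented_mul (word_class u) (word_class v) = word_class (u ++ v).
Proof.
by apply/word_classP/word_congr_cat; apply/word_classP; rewrite word_class_repr.
Qed.

Lemma presented_mulA : associative presented_mul.
Proof.
move=> x y z; rewrite -(word_class_repr x) -(word_class_repr y).
by rewrite -(word_class_repr z) !presented_mulE catA.
Qed.

Lemma presented_mul1 : left_id presented_one presented_mul.
Proof. by move=> x; rewrite -(word_class_repr x) presented_mulE. Qed.

Lemma presented_mulr1 : right_id presented_one presented_mul.
Proof. by move=> x; rewrite -(word_class_repr x) presented_mulE cats0. Qed.

HB.instance Definition _ := isMonoid.Build presented_monoid
  presented_mulA presented_mul1 presented_mulr1.

End Presentation.

(* The generators a_1, ..., a_n are indexed by ['I_n], i.e. shifted by one. *)
Inductive chinese_rel (n : nat) : seq 'I_n -> seq 'I_n -> Prop :=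
| chinese_rel_jik (i k j : 'I_n) :
    i <= k <= j -> chinese_rel [:: j; i; k] [:: j; k; i]
| chinese_rel_jki (i k j : 'I_n) :
    i <= k <= j -> chinese_rel [:: j; k; i] [:: k; j; i].

Definition chinese_monoid (n : nat) : monoidType :=
  presented_monoid (@chinese_rel n).

(* The generating set {p, q} is encoded as [bool]. *)
Definition bicyclic_p : bool := true.
Definition bicyclic_q : bool := false.

Inductive bicyclic_rel : seq bool -> seq bool -> Prop :=
| bicyclic_rel_qp : bicyclic_rel [:: bicyclic_q; bicyclic_p] [::].

Definition bicyclic_monoid : monoidType := presented_monoid bicyclic_rel.

Fixpoint tribonacci (k : nat) : nat :=
  match k with
  | (((k'.+1) as k1).+1 as k2).+1 =>
      tribonacci k2 + tribonacci k1 + tribonacci k'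
  | _ => 1
  end.

(* [Algebra.to_multiplicative] views the additive monoids [nat] and [int] as
   [monoidType]s; powers and products carry the componentwise operations. *)
Definition additive_nat : monoidType := Algebra.to_multiplicative nat.

Definition additive_int : monoidType := Algebra.to_multiplicative int.

Definition chinese_target (c d : nat) : monoidType :=
  ({ffun 'I_c -> additive_nat} *
   {ffun 'I_d -> bicyclic_monoid * additive_int})%type.

(* Main.v *)
(* For [s <= t] let the letters [k < s] act as [p], those with [k >= t] as [q]
   and the remaining ones as [1]; this is a homomorphism from the Chinese monoid
   to [B].  Every element of the Chinese monoid is a product of blocks, the
   block of the letter [o] being a product of pairs [o i] with [i < o] times a
   power of [o].  If [o] is the largest letter, then for [t <= o] the last block
   does not change the exponent of [p] in the image, while for [t > o] that
   exponent just counts the letters below [s]; so the exponents of [p] determine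
   the blocks one by one, from the largest letter down.  The cases [s = 0] and
   [t = n] only give letter counts, which are recovered from the total length and
   the images with [s = t].  Hence the ['C(n, 2)] homomorphisms with
   [0 < s <= t < n], together with the length, separate points.  Since
   [n - 1 <= T_n], this uses at most [n T_n] of the available coordinates; the
   other ones are filled with copies of the length. *)
Require Import Defs.
From HB Require Import structures.
From mathcomp Require Import all_boot all_order all_algebra.
From mathcomp Require Import generic_quotient zify.

Set Implicit Arguments.
Unset Strict Implicit.
Unset Printing Implicit Defensive.

(** * Homomorphisms out of presented monoids *)

Section Presented.
Variables (A : choiceType) (R : seq A -> seq A -> Prop).

Lemma word_class_cat (u v : seq A) :
  word_class R (u ++ v) = (word_class R u * word_class R v)%g.
Proof. exact: esym (presented_mulE R u v). Qed.

Lemma word_congr_flatmap (B : choiceType) (R' : seq B -> seq B -> Prop)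
    (g : A -> seq B) (u v : seq A) :
  (forall x y, R x y ->
     word_congr R' (flatten (map g x)) (flatten (map g y))) ->
  word_congr R u v -> word_congr R' (flatten (map g u)) (flatten (map g v)).
Proof.
move=> gR; elim=> {u v} [x u v y Ruv|u|u v _ IH|v u w _ IH1 _ IH2].
- by rewrite !map_cat !flatten_cat; apply/word_congr_ctx/gR.
- exact: word_congr_refl.
- exact: word_congr_sym.
- exact: word_congr_trans IH1 IH2.
Qed.

Lemma word_congr_size (u v : seq A) :
  (forall x y, R x y -> size x = size y) ->
  word_congr R u v -> size u = size v.
Proof.
move=> sR; elim=> {u v} [x u v y /sR Ruv|//|u v _ ->//|v u w _ -> _ ->//].
by rewrite !size_cat Ruv.
Qed.

(** The universal property of the presentation, with [F] given on whole words so that no product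
    over letters has to be formed in [M]. *)
Lemma presented_lift (M : monoidType) (F : seq A -> M) :
  F [::] = 1%g -> {morph F : u v / u ++ v >-> (u * v)%g} ->
  (forall u v, word_congr R u v -> F u = F v) ->
  exists f : UMagmaMorphism.type (presented_monoid R) M,
    forall w, f (word_class R w) = F w.
Proof.
move=> F1 FM FR; pose f (x : presented_monoid R) := F (repr x).
have fE w : f (word_class R w) = F w.
  by apply/FR/word_classP; rewrite word_class_repr.
have f_morph : monoid_morphism f.
  split=> [|x y]; first exact: etrans (fE [::]) F1.
  rewrite -[x]word_class_repr -[y]word_class_repr -word_class_cat.
  by rewrite !fE FM.
pose fm := isUMagmaMorphism.Build _ _ f f_morph.
by exists (HB.pack_for (UMagmaMorphism.type (presented_monoid R) M) f fm).
Qed.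

End Presented.

(* The pair [(x, y)] stands for the normal form [p^x q^y]; [bicyclic_step] is
   right multiplication by a generator. *)
Definition bicyclic_step (st : nat * nat) (b : bool) : nat * nat :=
  if b then (if st.2 is y.+1 then (st.1, y) else (st.1.+1, 0))
  else (st.1, st.2.+1).

(** Reading [q] and then [p] raises the second entry and lowers it again. So the state is an
    invariant of the class in B. *)
Lemma bicyclic_step_congr (u v : seq bool) st :
  word_congr bicyclic_rel u v ->
  foldl bicyclic_step st u = foldl bicyclic_step st v.
Proof.
move=> uv.
elim: uv st => {u v} [x u v y [] st|//|u v _ IH st|v u w _ IH1 _ IH2 st].
- by rewrite !foldl_cat /= -surjective_pairing.
- by rewrite IH.
- by rewrite IH1 IH2.
Qed.

(** * Splitting off the block of the largest letter *)

Section Chinese.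
Variable n : nat.
Implicit Types (i j k o : 'I_n) (u v w S : seq 'I_n) (s t : nat).

Local Notation cl := (word_class (@chinese_rel n)).

Lemma chinese_jik i k j : i <= k <= j -> cl [:: j; i; k] = cl [:: j; k; i].
Proof.
move=> ikj; apply/word_classP.
exact: (word_congr_rel [::] [::] (chinese_rel_jik ikj)).
Qed.

Lemma chinese_jki i k j : i <= k <= j -> cl [:: j; k; i] = cl [:: k; j; i].
Proof.
move=> ikj; apply/word_classP.
exact: (word_congr_rel [::] [::] (chinese_rel_jki ikj)).
Qed.

Lemma chinese_pair_commute i k j :
  i <= k <= j -> commute (cl [:: j; i]) (cl [:: k]).
Proof.
by move=> ikj; rewrite /commute -!word_class_cat chinese_jik// chinese_jki.
Qed.

(** For [i <= j] the pair [o i] commutes with both letters [o] and [j], as each lies between [i] and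
    [o]. *)
Lemma chinese_pairs_commute i j o :
  i <= o -> j <= o -> commute (cl [:: o; i]) (cl [:: o; j]).
Proof.
wlog ij : i j / i <= j.
  by case: (leqP i j) => [|/ltnW] ij H io jo; [|apply: commute_sym]; apply: H.
move=> io jo; rewrite (word_class_cat _ [:: o] [:: j]).
by apply: commuteM; apply: chinese_pair_commute; rewrite ?io ?ij ?leqnn.
Qed.

Lemma pair_commute_nseq i j m :
  i <= j -> commute (cl [:: j; i]) (cl (nseq m j)).
Proof.
move=> ij; elim: m => [|m IH]; first exact: commute1.
rewrite -[nseq m.+1 j]cat1s word_class_cat; apply: commuteM IH.
by apply: chinese_pair_commute; rewrite ij leqnn.
Qed.

Definition pair_word o S : seq 'I_n := flatten [seq [:: o; i] | i <- S].

Lemma pair_word_perm o S S' :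
  all (fun i => i <= o) S -> perm_eq S S' ->
  cl (pair_word o S) = cl (pair_word o S').
Proof.
elim: S S' => [|x S IH] S' /= => [_|/andP[xo So] SS'].
  by move/perm_size/esym/size0nil->.
have /path.splitPr E : x \in S' by rewrite -(perm_mem SS') mem_head.
case: E SS' => S1 S2; rewrite perm_sym perm_catC /= perm_cons => SS'.
have {SS'} SS' : perm_eq S (S1 ++ S2) by rewrite perm_sym perm_catC.
have : all (fun i => i <= o) S1.
  by move: So; rewrite (perm_all _ SS') all_cat => /andP[].
rewrite -[x :: S]cat1s /pair_word map_cat flatten_cat word_class_cat.
rewrite -/(pair_word o S) (IH _ So SS') {IH So SS'} /pair_word !map_cat /=.
rewrite !flatten_cat /= (word_class_cat _ _ (o :: x :: _)).
rewrite (word_class_cat _ [:: o; x] (flatten _)) (word_class_cat _ (flatten _)).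
rewrite !mulgA => S1o; congr (_ * _)%g.
elim: S1 S1o => [_|y S1 IH /= /andP[yo S1o]].
  by rewrite (mulg1 (_ : chinese_monoid n)) (mul1g (_ : chinese_monoid n)).
rewrite (word_class_cat _ [:: o; y] (flatten _)) mulgA.
by rewrite (chinese_pairs_commute xo yo) -!mulgA; congr (_ * _)%g; apply: IH.
Qed.

(** The letter travels left through the pairs: in [o x b] the larger of [x] and [b] moves to the
    front and the smaller stays paired with [o]. *)
Lemma pair_word_mul o S (a : 'I_n) :
  all (fun i => i < o) S -> a < o ->
  exists (b : 'I_n) S', [/\ b < o, all (fun i => i < o) S' &
    cl (rcons (pair_word o S) a) = cl (b :: pair_word o S')].
Proof.
elim: S => [_ ao|x S IH /= /andP[xo So] ao]; first by exists a, [::].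
have [b [S' [bo S'o E]]] := IH So ao.
have E' : cl (rcons (pair_word o (x :: S)) a) =
    (cl [:: o; x; b] * cl (pair_word o S'))%g.
  rewrite [in LHS]/pair_word /= -!rcons_cons -/(pair_word o S).
  rewrite -cats1 -[o :: x :: _]/([:: o; x] ++ _) -catA cats1 word_class_cat E.
  by rewrite -!word_class_cat.
case: (leqP x b) => xb.
- exists b, (x :: S'); rewrite /= xo S'o E'; split => //.
  have xbo : x <= b <= o by rewrite xb (ltnW bo).
  by rewrite (chinese_jik xbo) (chinese_jki xbo) -word_class_cat.
- exists x, (b :: S'); rewrite /= bo S'o E'; split => //.
  have bxo : b <= x <= o by rewrite (ltnW xb) (ltnW xo).
  by rewrite (chinese_jki bxo) -word_class_cat.
Qed.

(* Iterating this splitting yields the canonical form of the elements of the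
   Chinese monoid. *)
Lemma chinese_split o w :
  all (fun i => i <= o) w ->
  exists u S m, [/\ all (fun i => i < o) u, all (fun i => i < o) S &
    cl w = cl (u ++ pair_word o S ++ nseq m o)].
Proof.
elim/last_ind: w => [_|w a IH]; first by exists [::], [::], 0.
rewrite all_rcons => /andP[ao /IH[u [S [m [uo So E]]]]].
rewrite -cats1 word_class_cat E -!word_class_cat -!catA.
have [/val_inj->|a_neq_o] := eqVneq (val a) (val o).
  by exists u, S, m.+1; rewrite -[in RHS]addn1 nseqD.
have {}ao : a < o by rewrite ltn_neqAle a_neq_o.
(* Without a trailing [o], the letter [a] pushes some letter through the pairs into [u]. Otherwise
   one [o] joins [a] in a new pair, which commutes with the remaining power of [o]. *)
case: m E => [|m] _.
  have [b [S' [bo S'o E]]] := pair_word_mul So ao.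
  exists (rcons u b), S', 0; rewrite all_rcons bo uo; split => //.
  by rewrite /= cats0 cats1 cat_rcons !word_class_cat E.
exists u, (rcons S a), m; rewrite all_rcons ao So; split => //.
rewrite /pair_word map_rcons flatten_rcons -/(pair_word o S) -!catA.
rewrite !word_class_cat; congr (_ * (_ * _))%g.
rewrite -addn1 nseqD (word_class_cat _ _ [:: o]) -mulgA.
rewrite -(word_class_cat _ [:: o] [:: a]).
exact: esym (pair_commute_nseq m (ltnW ao)).
Qed.

(** * Exponents of p in the bicyclic images *)

Definition letter_image s t (k : nat) : seq bool :=
  if k < s then [:: bicyclic_p] else if k < t then [::] else [:: bicyclic_q].

Definition bicyclic_image s t w : seq bool :=
  flatten [seq letter_image s t (val i) | i <- w].

(** As letters increase, their images run through p, 1, q in this order. The relations then become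
    trivial or one of qpp = pqp and qpq = qqp, which follow from qp = 1. *)
Lemma bicyclic_image_congr s t u v :
  s <= t -> word_congr (@chinese_rel n) u v ->
  word_congr bicyclic_rel (bicyclic_image s t u) (bicyclic_image s t v).
Proof.
move=> st; apply: word_congr_flatmap => {}u {}v uv.
have qp x y :
    word_congr bicyclic_rel (x ++ [:: bicyclic_q, bicyclic_p & y]) (x ++ y).
  exact: (word_congr_rel x y bicyclic_rel_qp).
have qpp : word_congr bicyclic_rel [:: bicyclic_q; bicyclic_p; bicyclic_p]
    [:: bicyclic_p; bicyclic_q; bicyclic_p].
  apply: word_congr_trans (qp [::] [:: bicyclic_p]) _.
  exact/word_congr_sym/(qp [:: bicyclic_p] [::]).
have qpq : word_congr bicyclic_rel [:: bicyclic_q; bicyclic_p; bicyclic_q]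
    [:: bicyclic_q; bicyclic_q; bicyclic_p].
  apply: word_congr_trans (qp [::] [:: bicyclic_q]) _.
  exact/word_congr_sym/(qp [:: bicyclic_q] [::]).
case: uv => i k j ikj; rewrite /= /letter_image;
  (case: (ltnP i s) => ?; [|case: (ltnP i t) => ?]);
  (case: (ltnP k s) => ?; [|case: (ltnP k t) => ?]);
  (case: (ltnP j s) => ?; [|case: (ltnP j t) => ?]);
  by [exact: word_congr_refl | exact: qpp | exact: qpq | lia].
Qed.

Definition bicyclic_state s t w : nat * nat :=
  foldl bicyclic_step (0, 0) (bicyclic_image s t w).

Lemma bicyclic_state_congr s t u v :
  s <= t -> word_congr (@chinese_rel n) u v ->
  bicyclic_state s t u = bicyclic_state s t v.
Proof. by move=> st uv; apply/bicyclic_step_congr/bicyclic_image_congr. Qed.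

(** For [s = t] every letter acts as p or q, and the difference of the exponents is the number of
    p's minus the number of q's. *)
Lemma bicyclic_state_count s w :
  (bicyclic_state s s w).1 + size w =
  (bicyclic_state s s w).2 + 2 * count (fun i : 'I_n => i < s) w.
Proof.
elim/last_ind: w => // w i; rewrite /bicyclic_state /bicyclic_image.
rewrite map_rcons flatten_rcons foldl_cat size_rcons -cats1 count_cat /=.
rewrite /letter_image; case: (foldl _ _ _) => x y /=.
by case: (ltnP i s) => /= _; [case: y => [|y] /=|]; lia.
Qed.

(** No letter acts as q here, so nothing cancels. *)
Lemma p_exponent_lt s t w :
  all (fun i => i < t) w ->
  (bicyclic_state s t w).1 = count (fun i : 'I_n => i < s) w.
Proof.
move=> wt; suff -> : bicyclic_state s t w =
    (count (fun i : 'I_n => i < s) w, 0) by [].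
elim/last_ind: w wt => // w i IH; rewrite all_rcons => /andP[it /IH].
rewrite /bicyclic_state /bicyclic_image map_rcons flatten_rcons foldl_cat => ->.
rewrite -cats1 count_cat /letter_image it /=.
by case: (ltnP i s) => /= _; rewrite ?addn0 ?addn1.
Qed.

Lemma p_exponent0 t w : (bicyclic_state 0 t w).1 = 0.
Proof.
elim/last_ind: w => // w i; rewrite /bicyclic_state /bicyclic_image.
rewrite map_rcons flatten_rcons foldl_cat /letter_image /=.
by case: ltnP.
Qed.

(* In the last block every [o] contributes a factor [q], which cancels the [p]
   that may follow it. *)
Lemma p_exponent_split s t o u S m :
  s <= t -> t <= o ->
  (bicyclic_state s t (u ++ pair_word o S ++ nseq m o)).1 =
  (bicyclic_state s t u).1.
Proof.
move=> st to_; have os : (o < s) = false by lia.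
have ot : (o < t) = false by lia.
rewrite /bicyclic_state /bicyclic_image !map_cat !flatten_cat !foldl_cat.
set x := foldl _ (0, 0) _; have -> y : (foldl bicyclic_step y
    (flatten [seq letter_image s t (val i) | i <- nseq m o])).1 = y.1.
  by elim: m y => //= m IH y; rewrite {1}/letter_image os ot /= IH.
elim: S x => //= i S IH x.
rewrite {1}/letter_image os ot /= foldl_cat IH /letter_image.
by case: (i < s); case: (i < t).
Qed.

(** * Exponents of p separate points *)

Lemma perm_eq_count_lt S S' :
  (forall s, count (fun i : 'I_n => i < s) S =
             count (fun i : 'I_n => i < s) S') ->
  perm_eq S S'.
Proof.
move=> E; apply/allP => i _; apply/eqP => /=.
have H U : count (fun j : 'I_n => j < i.+1) U =
    count_mem i U + count (fun j : 'I_n => j < i) U.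
  elim: U => //= j U ->; rewrite ltnS leq_eqVlt -val_eqE.
  by case: eqVneq => [->|_] /=; rewrite ?ltnn; lia.
by have := E i.+1; rewrite !H E => /addIn.
Qed.

Lemma p_exponent_inj m w w' :
  m <= n -> all (fun i => i < m) w -> all (fun i => i < m) w' ->
  (forall s t, s <= t <= m ->
     (bicyclic_state s t w).1 = (bicyclic_state s t w').1) ->
  cl w = cl w'.
Proof.
elim: m w w' => [[|? ?] [|? ?] //|m IH] w w' mn wm w'm E.
pose o := Ordinal mn.
have [u [S [l [uo So Ew]]]] := @chinese_split o w wm.
have [u' [S' [l' [u'o S'o Ew']]]] := @chinese_split o w' w'm.
have {wm w'm} E s t : s <= t <= m.+1 ->
    (bicyclic_state s t (u ++ pair_word o S ++ nseq l o)).1 =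
    (bicyclic_state s t (u' ++ pair_word o S' ++ nseq l' o)).1.
  move=> stm; have st : s <= t by case/andP: stm.
  have /word_classP/(bicyclic_state_congr st) <- := Ew.
  have /word_classP/(bicyclic_state_congr st) <- := Ew'.
  exact: E.
(* Thresholds [t <= m] do not see the last block, so the induction hypothesis will apply to [u] and
   [u']. *)
have Eu s t : s <= t <= m ->
    (bicyclic_state s t u).1 = (bicyclic_state s t u').1.
  move=> /andP[st tm]; rewrite -(@p_exponent_split s t o u S l)//.
  by rewrite E ?st ?(leqW tm) // p_exponent_split.
have all_o U V r : all (fun i => i < o) U -> all (fun i => i < o) V ->
    all (fun i => i < m.+1) (U ++ pair_word o V ++ nseq r o).
  move=> Uo Vo; rewrite !all_cat all_nseq ltnSn orbT andbT.
  apply/andP; split; first by apply: sub_all Uo => i /ltnW.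
  by elim: V Vo => //= i V IHV /andP[io /IHV ->]; rewrite ltnSn ltnW.
have cnt U V r s : s <= m ->
    count (fun i : 'I_n => i < s) (U ++ pair_word o V ++ nseq r o) =
    count (fun i : 'I_n => i < s) U + count (fun i : 'I_n => i < s) V.
  move=> sm; have os : (o < s) = false by rewrite ltnNge sm.
  rewrite !count_cat count_nseq os addn0; congr (_ + _).
  by elim: V => //= i V ->; rewrite os.
(* At [t = m.+1] the exponent counts the letters below [s] in [u] and [S] together; the share of [u]
   is known from [t = m]. *)
have SS' : perm_eq S S'.
  apply: perm_eq_count_lt => s; wlog sm : s / s <= m => [H|].
    case: (leqP s m) => [/H//|ms].
    suff cm V : all (fun i => i < o) V -> count (fun i : 'I_n => i < s) V =
        count (fun i : 'I_n => i < m) V by rewrite !cm// H.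
    by move=> /allP Vo; apply: eq_in_count => i /Vo /= im; rewrite im; lia.
  have := E s m.+1; rewrite leqnn (leqW sm) => /(_ isT).
  rewrite !p_exponent_lt ?all_o // !cnt //.
  have := Eu s m; rewrite sm leqnn => /(_ isT).
  by rewrite !p_exponent_lt // => -> /addnI.
have uu' : cl u = cl u' by apply: IH => //; apply: ltnW.
(* At [s = t = m.+1] the exponent is the total length, and the lengths of [u] and [S] are already
   matched. *)
have ll' : l = l'.
  have := E m.+1 m.+1; rewrite leqnn => /(_ isT).
  rewrite !p_exponent_lt ?all_o // => cnt_eq.
  move: (all_o _ _ l uo So) (all_o _ _ l' u'o S'o); rewrite !all_count -cnt_eq.
  move=> /eqP-> /eqP; rewrite !size_cat !size_nseq.
  have := Eu m m; rewrite leqnn !p_exponent_lt // => /(_ isT).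
  move: uo u'o; rewrite !all_count => /eqP-> /eqP-> ->.
  have sz V : size (pair_word o V) = 2 * size V by elim: V => //= i V ->; lia.
  by rewrite !sz (perm_size SS') => /addnI/addnI.
rewrite Ew Ew' !word_class_cat uu' ll'.
rewrite (pair_word_perm _ SS') //.
by apply/allP => i /(allP So) /= /ltnW.
Qed.

End Chinese.

(** * Counting coordinates and assembling the embedding *)

Lemma tribonacci_gt0 k : 0 < tribonacci k.
Proof.
elim/ltn_ind: k => -[|[|[|k]]] // IH.
rewrite -[tribonacci _]/(tribonacci k.+2 + tribonacci k.+1 + tribonacci k).
by rewrite !addn_gt0 IH.
Qed.

(** This yields [2 * 'C(n, 2) = n * n.-1 <= n * tribonacci n], leaving a nonnegative [c]. *)
Lemma tribonacci_ge k : k <= (tribonacci k).+1.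
Proof.
elim: k => // -[|[|k]] // IH.
have := tribonacci_gt0 k.+1.
have := tribonacci_gt0 k.
rewrite -[tribonacci k.+3]/(tribonacci k.+2 + tribonacci k.+1 + tribonacci k).
by move: IH; lia.
Qed.

Lemma card_ltn_pairs n : #|{: {x : 'I_n * 'I_n | x.1 < x.2}}| = 'C(n, 2).
Proof.
rewrite card_sig -sum1_card -bin2_sum big_mkord.
rewrite -(pair_big_dep xpredT (fun i j : 'I_n => i < j) (fun _ _ => 1)) /=.
rewrite (exchange_big_dep xpredT) //=; apply: eq_bigr => j _.
have jn := ltnW (ltn_ord j).
by rewrite -(big_ord_widen n (fun=> 1) jn) sum1_card card_ord.
Qed.

Theorem corollary3p3p3 (n : nat) (hn : 1 <= n) :
  exists c d : nat, c + 2 * d = n * tribonacci n /\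
    exists f : UMagmaMorphism.type (chinese_monoid n)
                 (chinese_target c d),
      injective f.
Proof.
pose P : finType := {x : 'I_n * 'I_n | x.1 < x.2}.
pose d := #|P|; pose c := n * tribonacci n - 2 * d.
have dE : 2 * d = n * n.-1 by rewrite /d card_ltn_pairs -mul_bin_diag bin1.
have cd : c + 2 * d = n * tribonacci n.
  rewrite subnK // dE leq_mul2l; apply/orP; right.
  by have := tribonacci_ge n; lia.
exists c, d; split=> //.
(* A pair [i < j] encodes the thresholds [s = i.+1] and [t = j], that is, [0 < s <= t < n]. *)
pose s (k : 'I_d) := (val (enum_val k)).1.+1.
pose t (k : 'I_d) := val (val (enum_val k)).2.
have st k : s k <= t k by exact: (valP (enum_val k)).
pose F (w : seq 'I_n) : chinese_target c d :=
  ([ffun=> size w : additive_nat],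
   [ffun k => (word_class bicyclic_rel (bicyclic_image (s k) (t k) w),
               (size w)%:Z%R : additive_int)]).
have F1 : F [::] = 1%g.
  by congr (_, _); apply/ffunP => k; rewrite !ffunE.
have FM : {morph F : u v / u ++ v >-> (u * v)%g}.
  move=> u v; congr (_, _); apply/ffunP => k; rewrite !ffunE.
    by rewrite size_cat.
  by rewrite /bicyclic_image map_cat flatten_cat word_class_cat size_cat PoszD.
have FR u v : word_congr (@chinese_rel n) u v -> F u = F v.
  move=> uv; have uv_size : size u = size v.
    by apply: word_congr_size uv => _ _ [].
  congr (_, _); apply/ffunP => k; rewrite !ffunE uv_size //; congr (_, _).
  exact/word_classP/bicyclic_image_congr.
have [f fE] := presented_lift F1 FM FR.
exists f => x y; rewrite -[x]word_class_repr -[y]word_class_repr !fE.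
move: (repr x) (repr y) => u v [/ffunP Fc /ffunP Fd].
have state_eq a b : 0 < a <= b -> b < n ->
      bicyclic_state a b u = bicyclic_state a b v.
  move=> /andP[a_gt0 ab] bn; have an : a.-1 < n by lia.
  have ltab : Ordinal an < Ordinal bn by rewrite /=; lia.
  pose k := enum_rank (Sub (Ordinal an, Ordinal bn) ltab : P).
  have := Fd k; rewrite !ffunE => -[/word_classP + _].
  rewrite /s /t enum_rankK /= prednK // => /bicyclic_step_congr; exact.
have size_eq : size u = size v.
  (* For [n = 1] there are no bicyclic factors, so the length is read from a natural coordinate;
     otherwise an integer coordinate carries it. *)
  have [n1|n_gt1] := leqP n 1.
    have c_gt0 : 0 < c by move: cd dE; have := tribonacci_gt0 n; nia.
    by have := Fc (Ordinal c_gt0); rewrite !ffunE.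
  have d_gt0 : 0 < d by nia.
  by have := Fd (Ordinal d_gt0); rewrite !ffunE => -[].
have all_n (w : seq 'I_n) : all (fun i : 'I_n => i < n) w.
  by apply/allP => i _ /=.
apply: (p_exponent_inj (leqnn n)) => // a b /andP[ab].
(* For [b = n] the exponent is the number of letters below [a]. If [0 < a < n], the length and the
   image with [s = t = a] determine twice this number. *)
rewrite leq_eqVlt => /predU1P[->|bn].
  rewrite !p_exponent_lt //.
  have [->|a_gt0] := posnP a.
    by rewrite !(@eq_count _ _ pred0) // !count_pred0.
  have [an|an] := ltnP a n.
    have := bicyclic_state_count a u.
    rewrite state_eq ?a_gt0 ?leqnn // size_eq bicyclic_state_count => /addnI/eqP.
    by rewrite eqn_pmul2l // => /eqP.
  have all_a w : count (fun i : 'I_n => i < a) w = size w.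
    by apply/eqP; rewrite -all_count; apply/allP => i _ /=; apply: leq_trans an.
  by rewrite !all_a.
have [->|a_gt0] := posnP a; first by rewrite !p_exponent0.
by rewrite state_eq ?a_gt0.
Qed.
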